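(* Let $n\ge1$ and $\varphi=\mathcal{X}_{(0,1)}$. For $j\in\mathbb{Z}^+$ let $\Pi_j$ be the joint distribution of a positive random variable $\varepsilon_j$ and an $\mathbb{R}^n$-valued random vector $y_j$. Assume that $d\Pi_j=\gamma_j\,ds\,dy$ and that there are a constant $A>0$ and numbers $r_j>0$ such that, for every $j$, $\operatorname{supp}\gamma_j\subseteq[0,r_j]\times B(0,r_j)$ and $\|\gamma_j\|_\infty\le\frac{A}{r_j^{n+1}}$. Then there is a constant $C>0$, independent of $f$ and $x$, such that $\mathscr{M}f(x)\le C f^*(x)$ for every measurable $f$ on $\mathbb{R}^n$ and every $x\in\mathbb{R}^n$.
   Context: $\mathbb{Z}^+=\{1,2,3,\dots\}$; $\mathcal{X}_S$ is the indicator function of $S$; $B(x,r)$ is the open Euclidean ball in $\mathbb{R}^n$. The random variables $\varepsilon_j$ and vectors $y_j$ are defined on a probability space $(\Omega,\mathscr{F},\mathscr{P})$ with expectation $\mathscr{E}$, and $\Pi_j(E)=\mathscr{P}(\{\omega:(\varepsilon_j(\omega),y_j(\omega))\in E\})$ for Borel $E\subseteq\mathbb{R}^{n+1}$. The maximal operator is $$\mathscr{M}f(x)=\sup_{j\geq 1}\mathscr{E}\left[\int_{z\in\mathbb{R}^n}\frac{1}{\varepsilon_j^n(\omega)}\varphi\left(\frac{|x-y_j(\omega)-z|}{\varepsilon_j(\omega)}\right)|f(z)|\,dz\right].$$ The Hardy-Littlewood maximal function on centered balls is $f^*(x)=\sup_{r>0}\frac{1}{|B(x,r)|}\int_{B(x,r)}|f(z)|\,dz$.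 *)

(* Defs.v *)
From HB Require Import structures.
From mathcomp Require Import all_boot all_order all_algebra.
From mathcomp Require Import all_classical all_reals all_analysis measurable_realfun.
Set Implicit Arguments.
Unset Strict Implicit.
Unset Printing Implicit Defensive.
Import Order.TTheory GRing.Theory Num.Theory.
Import numFieldNormedType.Exports.
Local Open Scope classical_set_scope.
Local Open Scope ring_scope.

(* R^n is n.-tuple R: the library equips tuples with the product sigma-algebra,
   which is the Borel sigma-algebra of R^n. *)

Definition vzero (R : realType) (n : nat) : n.-tuple R := [tuple 0 | _ < n].

Definition vsub (R : realType) (n : nat) (x y : n.-tuple R) : n.-tuple R :=
  [tuple tnth x i - tnth y i | i < n].

Definition enorm (R : realType) (n : nat) (x : n.-tuple R) : R :=
  Num.sqrt (\sum_(i < n) tnth x i ^+ 2).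

Definition eball (R : realType) (n : nat) (x : n.-tuple R) (r : R) :
    set (n.-tuple R) :=
  [set z | enorm (vsub z x) < r].

(* lebesgue_measure lives on the alias measurableTypeR R; leb1 is the same
   measure on the canonical (convertible) Borel structure of R. *)
Definition leb1 (R : realType) : set R -> \bar R := @lebesgue_measure R.

Lemma leb1_0 (R : realType) : @leb1 R set0 = 0%E.
Proof. exact: (measure0 (@lebesgue_measure R)). Qed.

Lemma leb1_ge0 (R : realType) (A : set R) : (0 <= leb1 A)%E.
Proof. exact: (measure_ge0 (@lebesgue_measure R)). Qed.

Lemma leb1_sigma_additive (R : realType) : semi_sigma_additive (@leb1 R).
Proof. exact: (@measure_semi_sigma_additive _ _ _ (@lebesgue_measure R)). Qed.

Lemma leb1_sigma_finite (R : realType) : sigma_finite [set: R] (@leb1 R).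
Proof. exact: (@sigma_finiteT _ _ _ (@lebesgue_measure R)). Qed.

HB.instance Definition _ (R : realType) :=
  isMeasure.Build _ _ _ (@leb1 R) (@leb1_0 R) (@leb1_ge0 R)
    (@leb1_sigma_additive R).

HB.instance Definition _ (R : realType) :=
  Measure_isSigmaFinite.Build _ _ _ (@leb1 R) (@leb1_sigma_finite R).

(* Lebesgue measure on R^n, by recursion on n: a point mass on R^0, and on
   R^(n+1) the product of the measures of R and R^n, transported along
   (a, v) |-> a :: v. *)

Definition vcons (R : realType) (n : nat) (p : R * n.-tuple R) :
    n.+1.-tuple R := [tuple of p.1 :: p.2].

Lemma measurable_vcons (R : realType) (n : nat) :
  measurable_fun [set: R * n.-tuple R] (@vcons R n).
Proof. exact: measurable_cons. Qed.

Definition leb_cons (R : realType) (n : nat)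
    (mu : {sigma_finite_measure set (n.-tuple R) -> \bar R}) :
    set (n.+1.-tuple R) -> \bar R :=
  pushforward (@leb1 R \x mu)%E (@vcons R n).

Lemma leb_cons0 (R : realType) (n : nat)
    (mu : {sigma_finite_measure set (n.-tuple R) -> \bar R}) :
  leb_cons mu set0 = 0%E.
Proof. by rewrite /leb_cons /pushforward preimage_set0 measure0. Qed.

Lemma leb_cons_ge0 (R : realType) (n : nat)
    (mu : {sigma_finite_measure set (n.-tuple R) -> \bar R}) A :
  (0 <= leb_cons mu A)%E.
Proof. by rewrite /leb_cons /pushforward; apply: measure_ge0. Qed.

Lemma leb_cons_sigma_additive (R : realType) (n : nat)
    (mu : {sigma_finite_measure set (n.-tuple R) -> \bar R}) :
  semi_sigma_additive (leb_cons mu).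
Proof.
have := @measure_semi_sigma_additive _ _ _
  (measure_function_pushforward__canonical__measure_function_Measure
    (@leb1 R \x mu)%E (@measurable_vcons R n)).
exact.
Qed.

HB.instance Definition _ (R : realType) (n : nat)
    (mu : {sigma_finite_measure set (n.-tuple R) -> \bar R}) :=
  isMeasure.Build _ _ _ (leb_cons mu) (leb_cons0 mu) (leb_cons_ge0 mu)
    (@leb_cons_sigma_additive R n mu).

Lemma measurable_vuncons (R : realType) (n : nat) :
  measurable_fun [set: n.+1.-tuple R]
    (fun v => (thead v, [tuple of behead v]) : R * n.-tuple R).
Proof.
apply/measurable_fun_pairP; split => /=; last exact: measurable_behead.
exact: measurable_tnth.
Qed.

Lemma leb_cons_sigma_finite (R : realType) (n : nat)
    (mu : {sigma_finite_measure set (n.-tuple R) -> \bar R}) :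
  sigma_finite [set: n.+1.-tuple R] (leb_cons mu).
Proof.
have /sigma_finiteP[F [FT ndF Foo]] := @leb1_sigma_finite R.
have /sigma_finiteP[G [GT ndG Goo]] := sigma_finiteT mu.
pose u (v : n.+1.-tuple R) : R * n.-tuple R := (thead v, [tuple of behead v]).
exists (fun i => u @^-1` (F i `*` G i)).
  apply/esym/seteqP; split => // v _.
  have : [set: R] (u v).1 by [].
  have : [set: n.-tuple R] (u v).2 by [].
  rewrite FT GT => -[k _ Gk] [i _ Fi]; exists (maxn i k) => //; split.
    by move: Fi; exact/subsetPset/ndF/leq_maxl.
  by move: Gk; exact/subsetPset/ndG/leq_maxr.
move=> i; have [? ?] := Foo i; have [? ?] := Goo i; split.
  rewrite -[X in measurable X]setTI.
  by apply: measurable_vuncons => //; exact: measurableX.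
rewrite /leb_cons /pushforward.
suff -> : @vcons R n @^-1` (u @^-1` (F i `*` G i)) = F i `*` G i.
  by rewrite product_measure1E// lte_mul_pinfty// ge0_fin_numE.
rewrite -comp_preimage (_ : u \o _ = id)//; apply/funext => -[a v] /=.
by rewrite /u /vcons /= theadE; congr pair; exact: val_inj.
Qed.

HB.instance Definition _ (R : realType) (n : nat)
    (mu : {sigma_finite_measure set (n.-tuple R) -> \bar R}) :=
  Measure_isSigmaFinite.Build _ _ _ (leb_cons mu)
    (leb_cons_sigma_finite mu).

Fixpoint leb (R : realType) (n : nat) :
    {sigma_finite_measure set (n.-tuple R) -> \bar R} :=
  match n return {sigma_finite_measure set (n.-tuple R) -> \bar R} with
  | 0%N => [the {sigma_finite_measure set (0.-tuple R) -> \bar R}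
             of \d_[tuple]]
  | m.+1 => [the {sigma_finite_measure set (m.+1.-tuple R) -> \bar R}
             of leb_cons (leb R m)]
  end.

Lemma leb_box (R : realType) (n : nat) (a b : 'I_n -> R) :
  (forall i, a i <= b i) ->
  leb R n [set v | forall i, tnth v i \in `]a i, b i]] =
  (\prod_(i < n) (b i - a i))%:E.
Proof.
elim: n a b => [|n IH] a b ab.
  by rewrite big_ord0 /= diracE mem_set//; case.
rewrite big_ord_recl EFinM -IH => [|i]; last exact: ab.
have -> : (b ord0 - a ord0)%:E = leb1 `]a ord0, b ord0].
  rewrite /leb1 lebesgue_measure_itv /= lte_fin.
  have := ab ord0; rewrite le_eqVlt => /orP[/eqP ->|->]//.
  by rewrite ltxx subrr.
rewrite -product_measure1E//.
- rewrite /= /leb_cons /pushforward; congr (product_measure1 _ _ _).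
  apply/seteqP; split => -[x v] /=.
    move=> H; split; first by have := H ord0; rewrite tnth0 /=.
    by move=> i; have := H (lift ord0 i); rewrite /vcons tnthS.
  move=> [h0 hS] i; case: (unliftP ord0 i) => [j ->|->]; last by rewrite tnth0.
  by rewrite /vcons tnthS; exact: hS.
- rewrite (_ : mkset _ = \bigcap_(i in [set: 'I_n])
      ((fun v => tnth v i) @^-1` `]a (lift ord0 i), b (lift ord0 i)])); last first.
    by apply/seteqP; split => v /= H i; [move=> _|]; exact: H.
  apply: fin_bigcap_measurable => // i _.
  rewrite -[X in measurable X]setTI; exact: measurable_tnth.
Qed.

Definition leb_pair (R : realType) (n : nat) :
    {measure set (R * n.-tuple R)%type -> \bar R} :=
  [the {measure set (R * n.-tuple R)%type -> \bar R}
    of (@leb1 R \x leb R n)%E].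

(* Measurability with respect to the mu-completion of the sigma-algebra of T;
   for mu = leb R n this is Lebesgue measurability on R^n.  The library integral
   of a nonnegative g is the supremum of the integrals of the measurable simple
   functions below g; this is the Lebesgue integral also when g is only
   measurable for the completion. *)
Definition completed_measurable_fun (R : realType) (d d' : measure_display)
    (T : measurableType d) (U : measurableType d')
    (mu : set T -> \bar R) (f : T -> U) : Prop :=
  forall B : set U, measurable B -> completed_algebra_gen mu (f @^-1` B).

(* The essential support of g on R x R^n: the complement of the largest open
   set on which g vanishes almost everywhere.  It depends only on the almost
   everywhere class of g and is contained in the closure of {g <> 0}. *)
Definition supp (R : realType) (n : nat) (g : R * n.-tuple R -> R) :
    set (R * n.-tuple R) :=
  [set p | forall rho : R, 0 < rho ->
    ~ (@leb_pair R n).-negligible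
        ([set q | g q != 0] `&` (ball p.1 rho `*` eball p.2 rho))].

Definition Linfty_norm (R : realType) (n : nat) (g : R * n.-tuple R -> R) :
    \bar R :=
  ('N[leb_pair R n]_+oo[EFin \o g])%E.

Definition joint_law (R : realType) (n : nat) (d : measure_display)
    (Omega : measurableType d) (P : probability Omega R)
    (X : Omega -> R) (Y : Omega -> n.-tuple R) :
    set (R * n.-tuple R) -> \bar R :=
  pushforward P (fun w => (X w, Y w)).

Definition has_density (R : realType) (n : nat)
    (Pi : set (R * n.-tuple R) -> \bar R) (g : R * n.-tuple R -> R) : Prop :=
  completed_measurable_fun (leb_pair R n) g /\
  forall E : set (R * n.-tuple R), measurable E ->
    Pi E = (\int[leb_pair R n]_(p in E) (g p)%:E)%E.

(* Functions on R^n may take the values +oo and -oo.  The expectation is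
   written as an integral because the library's 'E_P is restricted to
   real-valued random variables. *)

Definition stochastic_maximal (R : realType) (n : nat) (d : measure_display)
    (Omega : measurableType d) (P : probability Omega R) (phi : R -> R)
    (eps : nat -> Omega -> R) (y : nat -> Omega -> n.-tuple R)
    (f : n.-tuple R -> \bar R) (x : n.-tuple R) : \bar R :=
  ereal_sup
    [set (\int[P]_w \int[leb R n]_z
            (((eps j w ^+ n)^-1
               * phi (enorm (vsub (vsub x (y j w)) z) / eps j w))%:E
             * `|f z|))%E
    | j in [set j : nat | (1 <= j)%N]].

Definition HL_maximal_centered (R : realType) (n : nat)
    (f : n.-tuple R -> \bar R) (x : n.-tuple R) : \bar R :=
  ereal_sup
    [set ((leb R n (eball x r))^-1 * \int[leb R n]_(z in eball x r) `|f z|)%E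
    | r in [set r : R | 0 < r]].

(* Main.v *)
Require Import Defs.
From mathcomp Require Import all_boot all_order all_algebra.
From mathcomp Require Import all_classical all_reals all_analysis measurable_realfun.
From mathcomp Require Import ess_sup_inf ring lra.
Set Implicit Arguments.
Unset Strict Implicit.
Unset Printing Implicit Defensive.
Import Order.TTheory GRing.Theory Num.Theory.
Import numFieldNormedType.Exports.
Local Open Scope classical_set_scope.
Local Open Scope ring_scope.

(** Fix an index and write [r] for its radius and [K] for the set
    [0, r] x B(0, r).  The density is almost everywhere bounded by A / r^(n+1)
    and vanishes almost everywhere off [K], so the joint law of (eps, y) is at
    most A / r^(n+1) times Lebesgue measure restricted to [K]
    ([has_density_le]).  The expectation is therefore at most A / r^(n+1) times
    the integral over (s, y) in [K] of s^-n times the integral of |f| over the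
    ball B(x - y, s).  Exchange the order of integration between y and z for
    each fixed s.  The points z that occur all lie in B(x, 2 r)
    ([ball_kernel_support]), and for each z the integral over y is
    s^-n |B(x - z, s)|, which is at most 2^n because a ball of radius s sits in
    a cube of side 2 s ([integral_ball_kernel]).  The factor s^-n, which is not
    bounded near s = 0, is thus cancelled by the integration in y.  What remains
    is (A / r^(n+1)) 2^n r times the integral of |f| over B(x, 2 r)
    ([integral_ball_kernel_le]).  That integral is at most (4 r)^n times the
    maximal function at x ([integral_eball_le_HL]), so all powers of r cancel
    and C = 8^n A works for every index.

    Two measure-theoretic points need care.  Tonelli's theorem asks for Borel
    functions while f is only Lebesgue measurable, so |f| is replaced by a Borel
    function below it that agrees with it off a null set
    ([completed_measurable_representative]).  The support is defined pointwise
    by local negligibility, and a countable base of rational boxes turns this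
    into vanishing almost everywhere off the support
    ([negligible_setC_supp]). *)

(** * Integrals, null sets and Borel representatives *)

Section General.
Local Open Scope ereal_scope.
Context (d : measure_display) (T : measurableType d) (R : realType).
Variable mu : {measure set T -> \bar R}.

(** The integral of a nonnegative function is a supremum over the simple
    functions below it, so monotonicity holds for functions that are not
    measurable. *)
Lemma ge0_le_integral_nonmeas (D : set T) (f g : T -> \bar R) :
  (forall t, D t -> 0 <= f t) -> (forall t, D t -> f t <= g t) ->
  \int[mu]_(t in D) f t <= \int[mu]_(t in D) g t.
Proof.
move=> f0 fg; have g0 t : D t -> 0 <= g t.
  by move=> Dt; exact: le_trans (f0 t Dt) (fg t Dt).
rewrite !ge0_integralE//; apply: ereal_sup_le => _ [h hf <-].
exists h => // t; apply: le_trans (hf t) _.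
by rewrite /patch; case: ifPn => // /set_mem Dt; exact: fg.
Qed.

(** Raising the dominating function to [+oo] on a measurable null set keeps its
    integral and makes the bound hold everywhere.  The dominated function may
    thus be a density or a kernel times |f|, which are measurable for the
    completion only. *)
Lemma ge0_ae_le_integral_nonmeas (D : set T) (f g : T -> \bar R) (N : set T) :
  measurable D -> mu.-negligible N ->
  (forall t, D t -> 0 <= f t) ->
  (forall t, D t -> 0 <= g t) -> measurable_fun D g ->
  (forall t, D t -> ~ N t -> f t <= g t) ->
  \int[mu]_(t in D) f t <= \int[mu]_(t in D) g t.
Proof.
move=> mD [M [mM M0 NM]] f0 g0 mg fg.
pose g' t := if t \in M then +oo else g t.
have g'0 t : D t -> 0 <= g' t by rewrite /g'; case: ifPn => // _; exact: g0.
have -> : \int[mu]_(t in D) g t = \int[mu]_(t in D) g' t.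
  apply: ge0_ae_eq_integral => //.
    have mM' : measurable_fun D (fun t => t \in M).
      apply: (measurable_fun_bool true) => //.
      rewrite [X in measurable (_ `&` X)](_ : _ = M); first exact: measurableI.
      by apply/seteqP; split => t /=; [move/set_mem|move/mem_set].
    apply: measurable_fun_if => //.
    by apply: measurable_funS mg => //; apply: subIsetl.
  exists M; split => // t /=; rewrite /g'; case: ifPn => [/set_mem //|_].
  by apply: contra_notP => _.
apply: ge0_le_integral_nonmeas => // t Dt; rewrite /g'; case: ifPn => tM.
  by rewrite leey.
by apply: fg => //; apply: contra_not (NM t) _; rewrite notin_setE in tM.
Qed.

Lemma negligible_bigcup_countType (I : countType) (F : I -> set T) :
  (forall i, mu.-negligible (F i)) -> mu.-negligible (\bigcup_i F i).
Proof.
move=> F0; pose G k := if unpickle k is Some i then F i else set0.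
have G0 : mu.-negligible (\bigcup_k G k).
  apply: negligible_bigcup => k; rewrite /G; case: unpickle => //.
  exact: negligible_set0.
apply: negligibleS G0 => t [i _ Fit].
by exists (pickle i) => //; rewrite /G pickleK.
Qed.

(** Discard the union of the null sets attached to the level sets
    {|f| > q}, q rational: outside it all these level sets are Borel, and they
    determine |f|.  Putting 0 on the discarded set keeps the representative
    below |f| everywhere, hence below it under any integral. *)
Lemma completed_measurable_representative (f : T -> \bar R) :
  completed_measurable_fun mu f ->
  exists g : T -> \bar R, [/\ measurable_fun [set: T] g,
    forall t, 0 <= g t, forall t, g t <= `|f t| &
    mu.-negligible [set t | g t != `|f t|]].
Proof.
move=> mf.
have level (q : rat) : exists AN : set T * set T,
    [/\ measurable AN.1, measurable AN.2, mu AN.2 = 0 &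
     forall t, ~ AN.2 t -> (AN.1 t <-> (ratr q)%:E < `|f t|)].
  have mB : measurable [set y : \bar R | (ratr q)%:E < `|y|].
    rewrite -[X in measurable X]setTI.
    exact: emeasurable_fun_lt.
  have [A mA [N [M [mM M0 NM]]] E] := mf _ mB.
  exists (A, M); split => //= t Mt.
  have -> : (ratr q)%:E < `|f t| <-> (A `|` N) t by rewrite E.
  by split=> [|[//|/NM]]; [left|].
pose F q := sval (cid (level q)).
have FP q : [/\ measurable (F q).1, measurable (F q).2, mu (F q).2 = 0 &
     forall t, ~ (F q).2 t -> ((F q).1 t <-> (ratr q)%:E < `|f t|)].
  exact: svalP (cid (level q)).
pose N := \bigcup_(q in [set: rat]) (F q).2.
have mN : measurable N by apply: bigcupT_measurable_rat => q; have [] := FP q.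
have N0 : mu.-negligible N.
  apply: negligible_bigcup_countType => q.
  by have [_ m2 m0 _] := FP q; exists (F q).2; split.
pose g t := if t \in N then 0 else `|f t|.
have g0 t : 0 <= g t by rewrite /g; case: ifP.
exists g; split => //.
- move=> _; apply: (measurability _ (ErealGenOInfty.measurableE R)) => //.
  move=> _ [_ [x ->] <-]; rewrite setTI.
  have [x0|x0] := ltP x 0%R.
    rewrite (_ : _ @^-1` _ = setT)//; apply/seteqP; split => // t _ /=.
    by rewrite in_itv/= andbT (lt_le_trans _ (g0 t)).
  rewrite (_ : _ @^-1` _ = \bigcup_(q in [set: rat])
      (if (x < ratr q)%R then (F q).1 `\` N else set0)).
    apply: bigcupT_measurable_rat => q; case: ifP => // _.
    by apply: measurableD => //; have [] := FP q.
  apply/seteqP; split => t /=; rewrite in_itv/= andbT /g.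
    case: ifPn => [_|]; first by rewrite lte_fin ltNge x0.
    rewrite notin_setE => tN xf.
    have [q xq qf] : exists2 q : rat, (x < ratr q)%R & (ratr q)%:E < `|f t|.
      case: `|f t| xf => [y||//].
        by rewrite lte_fin => /rat_in_itvoo[q]; rewrite in_itv/= => /andP[? ?];
          exists q; rewrite ?lte_fin.
      have /rat_in_itvoo[q] : (x < x + 1)%R by rewrite ltrDl.
      by rewrite in_itv/= => /andP[? _] _; exists q; rewrite ?ltry.
    exists q => //; rewrite xq; split => //.
    by have [_ _ _ ->//] := FP q; apply: contra_not tN => ?; exists q.
  move=> [q _]; case: ifP => // xq [Fq tN]; rewrite memNset//.
  have [_ _ _ Fqt] := FP q; apply: lt_trans (_ : (ratr q)%:E < _).
    by rewrite lte_fin.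
  by apply/Fqt => //; apply: contra_not tN => ?; exists q.
- by move=> t; rewrite /g; case: ifP.
- apply: negligibleS N0 => t /=; rewrite /g; case: ifPn => [/set_mem//|_].
  by rewrite eqxx.
Qed.

End General.

Section Dominated.
Local Open Scope ereal_scope.
Context (d : measure_display) (T : measurableType d) (R : realType).
Variables (m mu : {measure set T -> \bar R}).

(** The bound gives both [m (~` K) = 0], so that the integral can be restricted
    to [K], and [m <= c mu]. *)
Lemma ge0_integral_dominated (c : R) (K : set T) (h : T -> \bar R) :
  (0 <= c)%R -> measurable K ->
  (forall E, measurable E -> m E <= c%:E * mu (E `&` K)) ->
  (forall t, 0 <= h t) -> measurable_fun [set: T] h ->
  \int[m]_t h t <= c%:E * \int[mu]_(t in K) h t.
Proof.
move=> c0 mK mle h0 mh.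
have mKc : m (~` K) = 0.
  apply/eqP; rewrite -measure_le0 (le_trans (mle _ _))//; first exact: measurableC.
  by rewrite setICl measure0 mule0.
rewrite (ge0_negligible_integral (measurableC mK))// setTD setCK.
rewrite -[leRHS](ge0_integral_mscale _ mK (NngNum c0))//; last exact: measurable_funTS.
apply: ge0_le_measure_integral => // E mE; rewrite (le_trans (mle _ mE))//.
rewrite /mscale/= lee_wpmul2l ?lee_fin// le_measure ?inE//.
exact: measurableI.
Qed.

End Dominated.

(** * Euclidean balls and their volume *)

Section Euclid.
Context (R : realType) (n : nat).
Implicit Types x y z : n.-tuple R.

Lemma enorm_ge0 x : 0 <= enorm x.
Proof. exact: sqrtr_ge0. Qed.

Lemma enorm_sqr x : enorm x ^+ 2 = \sum_(i < n) tnth x i ^+ 2.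
Proof. by rewrite sqr_sqrtr// sumr_ge0// => i _; exact: sqr_ge0. Qed.

Lemma tnth_le_enorm x i : `|tnth x i| <= enorm x.
Proof.
rewrite -[leLHS](@ger0_norm _ `|_|)// -sqrtr_sqr ler_sqrt; last first.
  by rewrite sumr_ge0// => j _; exact: sqr_ge0.
rewrite real_normK ?num_real// (bigD1 i)//= lerDl sumr_ge0// => j _.
exact: sqr_ge0.
Qed.

Lemma enorm_le x (t : R) : 0 <= t -> (forall i, `|tnth x i| <= t) ->
  enorm x <= n%:R * t.
Proof.
move=> t0 xt; rewrite -[leRHS]ger0_norm ?mulr_ge0// -sqrtr_sqr.
rewrite ler_sqrt ?sqr_ge0//.
apply: (@le_trans _ _ (\sum_(i < n) t ^+ 2)).
  apply: ler_sum => i _; rewrite -[leLHS]real_normK ?num_real//.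
  by rewrite lerXn2r// nnegrE.
rewrite sumr_const card_ord exprMn -[leLHS]mulr_natl ler_wpM2r ?sqr_ge0//.
by rewrite -natrX ler_nat -mulnn; case: (n) => // m; rewrite leq_pmulr.
Qed.

(** This is |u + v|^2 <= 2 |u|^2 + 2 |v|^2 with u = - y and v = - (x - y - z).
    It replaces the triangle inequality: if both |u| and |v| are below r, it
    gives |u + v| < 2 r just as well. *)
Lemma enorm_parallelogram x y z :
  enorm (vsub z x) ^+ 2 <=
  2 * enorm y ^+ 2 + 2 * enorm (vsub (vsub x y) z) ^+ 2.
Proof.
rewrite !enorm_sqr !mulr_sumr -big_split/=; apply: ler_sum => i _.
rewrite !tnth_mktuple.
set a := tnth x i; set b := tnth y i; set c := tnth z i.
suff : 0 <= (2 * b - (a - c)) ^+ 2 by nra.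
exact: sqr_ge0.
Qed.

(** Read as a condition on y, |x - y - z| < s says that y is in B(x - z, s). *)
Lemma enorm_vsubAC x y z :
  enorm (vsub (vsub x y) z) = enorm (vsub y (vsub x z)).
Proof.
congr Num.sqrt; apply: eq_bigr => i _; rewrite !tnth_mktuple.
by ring.
Qed.

Lemma eball_sub_box x (s : R) z : enorm (vsub z x) < s ->
  forall i, tnth z i \in `]tnth x i - s, tnth x i + s].
Proof.
move=> zs i; have := le_lt_trans (tnth_le_enorm (vsub z x) i) zs.
rewrite tnth_mktuple ltr_norml in_itv/= => /andP[? ?].
by apply/andP; split; lra.
Qed.

Lemma measurable_enorm_vsub (d : measure_display) (T : measurableType d)
    (u v : T -> n.-tuple R) :
  measurable_fun [set: T] u -> measurable_fun [set: T] v ->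
  measurable_fun [set: T] (fun t => enorm (vsub (u t) (v t))).
Proof.
move=> mu mv; rewrite /enorm.
apply: (@measurableT_comp _ _ _ _ _ _ (@Num.sqrt R)).
  exact: continuous_measurable_fun (@sqrt_continuous R).
apply: measurable_sum => i; under eq_fun do rewrite tnth_mktuple.
apply: measurable_funX; apply: measurable_funB.
  by move/measurable_fun_tnthP : mu; exact.
by move/measurable_fun_tnthP : mv; exact.
Qed.

Lemma measurable_vsub (d : measure_display) (T : measurableType d)
    (u v : T -> n.-tuple R) :
  measurable_fun [set: T] u -> measurable_fun [set: T] v ->
  measurable_fun [set: T] (fun t => vsub (u t) (v t)).
Proof.
move=> mu mv; apply/measurable_fun_tnthP => i.
rewrite (_ : _ \o _ = fun t => tnth (u t) i - tnth (v t) i); last first.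
  by apply/funext => t /=; rewrite tnth_mktuple.
apply: measurable_funB.
  by move/measurable_fun_tnthP : mu; exact.
by move/measurable_fun_tnthP : mv; exact.
Qed.

Lemma measurable_eball x s : measurable (eball x s).
Proof.
rewrite -[X in measurable X]setTI.
have : measurable_fun [set: n.-tuple R] (fun z => enorm (vsub z x) < s).
  apply: measurable_fun_ltr => //.
  by apply: measurable_enorm_vsub.
by move=> /(_ measurableT [set true] I).
Qed.

Lemma measurable_box (a b : 'I_n -> R) :
  measurable [set v : n.-tuple R | forall i, tnth v i \in `]a i, b i]].
Proof.
rewrite (_ : mkset _ = \bigcap_(i in [set: 'I_n])
    ((fun v => tnth v i) @^-1` `]a i, b i])); last first.
  by apply/seteqP; split => v /= H i; [move=> _|]; exact: H.
apply: fin_bigcap_measurable => // i _.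
by rewrite -[X in measurable X]setTI; exact: measurable_tnth.
Qed.

Lemma leb_eball_le x (s : R) : 0 <= s ->
  (leb R n (eball x s) <= ((2 * s) ^+ n)%:E)%E.
Proof.
move=> s0; have -> : (2 * s) ^+ n =
    \prod_(i < n) ((tnth x i + s) - (tnth x i - s)).
  rewrite -[X in _ ^+ X]card_ord -prodr_const; apply: eq_bigr => i _; ring.
rewrite -leb_box; last by move=> i; lra.
apply: le_measure; rewrite ?inE.
- exact: measurable_eball.
- exact: measurable_box.
- by move=> z /eball_sub_box.
Qed.

(** The cube of side s / (n + 1) with upper corner x lies in the ball, since its
    points are within n s / (n + 1) < s of x. *)
Lemma leb_eball_gt0 x (s : R) : 0 < s -> (0 < leb R n (eball x s))%E.
Proof.
move=> s0; pose t := s / n.+1%:R.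
have t0 : 0 < t by rewrite divr_gt0.
apply: (@lt_le_trans _ _ (leb R n
    [set v | forall i, tnth v i \in `]tnth x i - t, tnth x i]])).
  rewrite leb_box; last by move=> i; rewrite gerBl ltW.
  by rewrite lte_fin prodr_gt0// => i _; rewrite opprB addrC subrK.
apply: le_measure; rewrite ?inE.
- exact: measurable_box.
- exact: measurable_eball.
- move=> z /= zt; apply: (@le_lt_trans _ _ (n%:R * t)).
    apply: enorm_le => [|i]; first exact: ltW.
    rewrite tnth_mktuple; have := zt i; rewrite in_itv/= ler_norml.
    by move=> /andP[? ?]; apply/andP; split; lra.
  by rewrite /t mulrA ltr_pdivrMr// mulrC ltr_pM2l// ltr_nat.
Qed.

End Euclid.

(** * Densities with bounded support *)

Section Density.
Context (R : realType) (n : nat).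

Lemma rat_approx (t e : R) : 0 < e -> exists q : rat, `|t - ratr q| < e.
Proof.
move=> e0; have /rat_in_itvoo[q] : t - e < t + e by lra.
rewrite in_itv/= => /andP[? ?]; exists q.
by rewrite ltr_norml; apply/andP; split; lra.
Qed.

Definition rat_box (i : rat * n.-tuple rat * nat) : set (R * n.-tuple R) :=
  [set q | `|q.1 - ratr i.1.1| < i.2.+1%:R^-1 /\
    forall k, `|tnth q.2 k - ratr (tnth i.1.2 k)| < i.2.+1%:R^-1].

(** Two points of a box with half side e differ by less than 2 e in each
    coordinate, so by less than 2 n e in norm; hence the condition
    2 (n + 1) e < rho on the half side. *)
Lemma rat_box_basis (p : R * n.-tuple R) (rho : R) : 0 < rho ->
  exists i, rat_box i p /\ rat_box i `<=` ball p.1 rho `*` eball p.2 rho.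
Proof.
move=> rho0; pose c : R := 2 * n.+1%:R / rho.
have c0 : 0 < c by rewrite divr_gt0// mulr_gt0.
pose k := Num.truncn c; have ck : c < k.+1%:R by exact: truncnS_gt.
pose e : R := k.+1%:R^-1.
have e0 : 0 < e by rewrite invr_gt0.
have ne : n.+1%:R * (2 * e) < rho.
  rewrite /e mulrA ltr_pdivrMr// mulrC (mulrC rho).
  by move: ck; rewrite /c ltr_pdivrMr.
have [a pa] := rat_approx p.1 e0.
have /choice[v pv] : forall i, exists q : rat, `|tnth p.2 i - ratr q| < e.
  by move=> i; exact: rat_approx.
exists (a, [tuple v i | i < n], k); split.
  by split => // i /=; rewrite tnth_mktuple; exact: pv.
move=> q [/= qa qv]; split => /=.
  rewrite /ball/= (le_lt_trans (ler_distD (ratr a) _ _))//.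
  apply: (@lt_trans _ _ (e + e)); first by rewrite ltrD// distrC.
  by apply: le_lt_trans ne; rewrite -natr1 mulrDl mul1r; have := mulr_ge0 (ler0n R n) (ltW e0); lra.
apply: (@le_lt_trans _ _ (n%:R * (2 * e))).
  apply: enorm_le => [|i]; first by rewrite mulr_ge0// ltW.
  rewrite tnth_mktuple (le_trans (ler_distD (ratr (v i)) _ _))//.
  rewrite mulr_natl mulr2n lerD// ltW//.
    by have := qv i; rewrite tnth_mktuple.
  by rewrite distrC.
by apply: le_lt_trans ne; rewrite ler_wpM2r ?ler_nat// mulr_ge0// ltW.
Qed.

(** Lindelof's argument: a point off the support where [g] does not vanish lies
    in a rational box on which [g] vanishes almost everywhere, and there are
    countably many boxes. *)
Lemma negligible_setC_supp (g : R * n.-tuple R -> R) :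
  (@leb_pair R n).-negligible ([set q | g q != 0] `\` supp g).
Proof.
pose F i := [set q : R * n.-tuple R |
  (@leb_pair R n).-negligible ([set q | g q != 0] `&` rat_box i) /\
  ([set q | g q != 0] `&` rat_box i) q].
have F0 : (@leb_pair R n).-negligible (\bigcup_i F i).
  apply: negligible_bigcup_countType => i.
  have [neg|nneg] := pselect ((@leb_pair R n).-negligible
    ([set q | g q != 0] `&` rat_box i)).
    by apply: negligibleS neg => q [].
  rewrite (_ : F i = set0); first exact: negligible_set0.
  by apply/seteqP; split => // q [].
apply: negligibleS F0 => p [gp].
rewrite /supp /= => /existsNP[rho] /not_implyP[rho0] /contrapT neg.
have [i [ip ib]] := rat_box_basis p rho0.
exists i => //; split; last by split.
by apply: negligibleS neg => q [gq /ib].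
Qed.

Lemma Linfty_norm_ae (g : R * n.-tuple R -> R) (c : R) :
  (Linfty_norm g <= c%:E)%E ->
  (@leb_pair R n).-negligible [set q | ~~ (`|g q| <= c)].
Proof.
rewrite /Linfty_norm unlock /Lnorm; case: ifPn => [_|].
  move/ess_supP => H; apply: negligibleS H => q /=.
  by move=> /negP gq; rewrite lee_fin => /gq.
rewrite -leNgt measure_le0 => /eqP H0 _; exists setT; split => //.
Qed.

(** The integral of [g] is at most that of its positive part, which is almost
    everywhere below [c] times the indicator of [K]. *)
Lemma has_density_le (Pi : set (R * n.-tuple R) -> \bar R)
    (g : R * n.-tuple R -> R) (c : R) (K E : set (R * n.-tuple R)) :
  has_density Pi g -> (Linfty_norm g <= c%:E)%E -> 0 <= c ->
  supp g `<=` K -> measurable K -> measurable E ->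
  (Pi E <= c%:E * leb_pair R n (E `&` K))%E.
Proof.
move=> [_ PiE] gc c0 gK mK mE; rewrite PiE//.
pose h p := (c * \1_K p)%:E.
have h0 p : (0 <= h p)%E by rewrite lee_fin mulr_ge0.
have mh : measurable_fun [set: R * n.-tuple R] h.
  by apply/measurable_EFinP; apply: measurable_funM => //; exact: measurable_indic.
have -> : (c%:E * leb_pair R n (E `&` K) = \int[leb_pair R n]_(p in E) h p)%E.
  rewrite /h; under eq_integral do rewrite EFinM.
  rewrite ge0_integralZl//; last by apply/measurable_EFinP; exact: measurable_indic.
  by rewrite integral_indic// setIC.
rewrite integralE; apply: (@le_trans _ _
  (\int[leb_pair R n]_(p in E) (fun q => (g q)%:E)^\+ p)%E).
  by rewrite -[leRHS]sube0 leeB// integral_ge0.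
apply: (@ge0_ae_le_integral_nonmeas _ _ _ _ _ _ _
  ([set q | ~~ (`|g q| <= c)] `|` ([set q | g q != 0] `\` supp g))) => //.
- by apply: negligibleU; [exact: Linfty_norm_ae|exact: negligible_setC_supp].
- exact: measurable_funTS.
- move=> p _; rewrite not_orE => -[/negP/negPn gp] gs; rewrite unlock.
  rewrite ge_max h0 andbT /h lee_fin indicE.
  have [pK|pK] := boolP (p \in K); first by rewrite mulr1 (le_trans (ler_norm _)).
  rewrite mulr0 leNgt; apply/negP => g0; apply: gs; split => /=.
    by rewrite gt_eqF.
  by move/gK/mem_set; exact/negP.
Qed.

End Density.

(** * The averaging kernel *)

Section Kernel.
Context (R : realType) (n : nat).
Implicit Types (x z : n.-tuple R) (p : R * n.-tuple R).

(** With [p] = (s, y), this is s^-n phi(|x - y - z| / s), except that phi is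
    replaced by the indicator of [0, 1); the two differ at one z only, and the
    kernel without the puncture is the indicator of a ball.  It vanishes for
    s <= 0, so it is nonnegative for every real s. *)
Definition ball_kernel x p z : R :=
  if enorm (vsub (vsub x p.2) z) < p.1 then (p.1 ^+ n)^-1 else 0.

Lemma ball_kernel_ge0 x p z : 0 <= ball_kernel x p z.
Proof.
rewrite /ball_kernel; case: ifPn => // /(le_lt_trans (enorm_ge0 _)) p0.
by rewrite invr_ge0 exprn_ge0// ltW.
Qed.

Lemma measurable_invr : measurable_fun [set: R] (@GRing.inv R).
Proof.
rewrite (_ : GRing.inv = fun s : R => if s == 0 then 0 else s^-1); last first.
  by apply/funext => s; case: eqP => // ->; rewrite invr0.
apply: measurable_fun_if => //.
- exact: measurable_fun_eqr.
apply: open_continuous_measurable_fun.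
  rewrite setTI (_ : _ @^-1` _ = [set s | s != 0]); first exact: open_neq.
  by apply/seteqP; split => s /=; [move/negbT|move/negbTE].
by move=> s; rewrite inE/= => -[_ /negbT]; exact: inv_continuous.
Qed.

Lemma measurable_ball_kernel x :
  measurable_fun [set: (R * n.-tuple R) * n.-tuple R]
    (fun q => ball_kernel x q.1 q.2).
Proof.
apply: measurable_fun_ifT => //.
- apply: measurable_fun_ltr.
    apply: measurable_enorm_vsub => //; apply: measurable_vsub => //.
    exact: measurableT_comp.
  exact: measurableT_comp.
- apply: (measurableT_comp measurable_invr).
  by apply: measurable_funX; exact: measurableT_comp.
Qed.

Lemma ball_kernel_support x z (r : R) p : p.1 \in `[0, r] -> eball (vzero R n) r p.2 ->
  ball_kernel x p z != 0 -> eball x (2 * r) z.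
Proof.
rewrite in_itv/= => /andP[p0 pr] yr; rewrite /ball_kernel; case: ifPn; last by rewrite eqxx.
move=> zs _; have yr' : enorm p.2 < r.
  move: yr; rewrite /eball/=; congr (_ < _); congr Num.sqrt.
  by apply: eq_bigr => i _; rewrite !tnth_mktuple subr0.
rewrite /eball/=; have := enorm_parallelogram x p.2 z.
move: (enorm_ge0 (vsub (vsub x p.2) z)) (enorm_ge0 p.2) (enorm_ge0 (vsub z x)) zs yr'.
move: (enorm _) (enorm p.2) (enorm (vsub z x)) => a b c a0 b0 c0 ap br.
by move=> cab; rewrite ltNge; apply/negP => rc; nra.
Qed.

Local Open Scope ereal_scope.

(** Integrating over the centre y gives s^-n |B(x - z, s)|: the singularity of
    the factor s^-n at 0 is compensated by the volume of the ball. *)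
Lemma integral_ball_kernel x z (s : R) : (0 <= s)%R ->
  \int[leb R n]_y (ball_kernel x (s, y) z)%:E <= (2 ^+ n)%:E.
Proof.
move=> s0.
have -> : (fun y => (ball_kernel x (s, y) z)%:E) =
    (fun y => ((s ^+ n)^-1)%:E * (\1_(eball (vsub x z) s) y)%:E).
  apply/funext => y; rewrite /ball_kernel/= enorm_vsubAC indicE -EFinM.
  case: ifPn => [ys|/negP ys]; first by rewrite mem_set// mulr1.
  by rewrite memNset// mulr0.
have mb := measurable_eball (vsub x z) s.
rewrite ge0_integralZl ?lee_fin ?invr_ge0 ?exprn_ge0//; last first.
  by apply/measurable_EFinP; exact: measurable_indic.
rewrite integral_indic// setIT.
apply: (@le_trans _ _ (((s ^+ n)^-1)%:E * ((2 * s) ^+ n)%:E)).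
  by rewrite lee_wpmul2l ?leb_eball_le// lee_fin invr_ge0 exprn_ge0.
rewrite -EFinM lee_fin exprMn mulrCA ler_piMr ?exprn_ge0//.
(* for s = 0 and n > 0 the inverse of s ^+ n is 0 and so is the product *)
have [->|sn0] := eqVneq (s ^+ n)%R 0%R; first by rewrite mulr0.
by rewrite mulVf.
Qed.

Lemma measurable_ball_kernel_integral x (g : n.-tuple R -> \bar R) :
  measurable_fun [set: n.-tuple R] g -> (forall z, 0 <= g z) ->
  measurable_fun [set: R * n.-tuple R]
    (fun p => \int[leb R n]_z ((ball_kernel x p z)%:E * g z)).
Proof.
move=> mg g0.
pose F (q : (R * n.-tuple R) * n.-tuple R) := (ball_kernel x q.1 q.2)%:E * g q.2.
apply: (@measurable_fun_fubini_tonelli_F _ _ _ _ _ (leb R n) F).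
  apply: emeasurable_funM; first by apply/measurable_EFinP; exact: measurable_ball_kernel.
  exact: measurableT_comp.
by move=> q; rewrite mule_ge0// lee_fin ball_kernel_ge0.
Qed.

(** The constraint on y in [K] is spent on confining z to B(x, 2 r); afterwards
    y may range over all of R^n, and Tonelli's theorem in (y, z) at fixed s
    leaves the bound 2^n for the y-integral and the length r for s. *)
Lemma integral_ball_kernel_le x (r : R) (g : n.-tuple R -> \bar R) :
  (0 <= r)%R ->
  measurable_fun [set: n.-tuple R] g -> (forall z, 0 <= g z) ->
  \int[leb_pair R n]_(p in `[0%R, r] `*` eball (vzero R n) r)
     \int[leb R n]_z ((ball_kernel x p z)%:E * g z) <=
  (2 ^+ n * r)%:E * \int[leb R n]_(z in eball x (2 * r)) g z.
Proof.
move=> r0 mg g0.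
have mk := measurable_ball_kernel x.
pose gB z := (\1_(eball x (2 * r)) z)%:E * g z.
have gB0 z : 0 <= gB z by rewrite mule_ge0// lee_fin.
have mgB : measurable_fun [set: n.-tuple R] gB.
  apply: emeasurable_funM => //; apply/measurable_EFinP.
  by apply: measurable_indic; exact: measurable_eball.
pose I p : R := \1_`[0%R, r]%classic p.1.
pose F (q : (R * n.-tuple R) * n.-tuple R) :=
  (I q.1)%:E * (ball_kernel x q.1 q.2)%:E * gB q.2.
have F0 q : 0 <= F q by rewrite !mule_ge0// lee_fin// ball_kernel_ge0.
have mF : measurable_fun [set: (R * n.-tuple R) * n.-tuple R] F.
  apply: emeasurable_funM; last exact: measurableT_comp.
  apply: emeasurable_funM; last exact/measurable_EFinP.
  apply/measurable_EFinP/(@measurableT_comp _ _ _ _ _ _ (\1_`[0%R, r]%classic : R -> R)).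
    exact: measurable_indic.
  exact: measurableT_comp.
(* on K the kernel vanishes unless z is in the ball, so F dominates it *)
apply: (@le_trans _ _ (\int[leb_pair R n]_p \int[leb R n]_z F (p, z))).
  rewrite integral_mkcond; apply: ge0_le_integral_nonmeas => p _.
    rewrite /patch; case: ifP => // _; apply: integral_ge0 => z _.
    by rewrite mule_ge0// lee_fin ball_kernel_ge0.
  rewrite /patch; case: ifPn => [/set_mem[p1 p2]|_]; last exact: integral_ge0.
  apply: ge0_le_integral_nonmeas => z _.
    by rewrite mule_ge0// lee_fin ball_kernel_ge0.
  rewrite /F /I/= indicE mem_set// mul1e.
  have [->|kz] := eqVneq (ball_kernel x p z) 0%R; first by rewrite !mul0e.
  by rewrite /gB indicE mem_set ?mul1e//; exact: ball_kernel_support kz.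
rewrite [X in _ <= _ * X]integral_mkcond.
rewrite (_ : _ \_ _ = gB); last first.
  apply/funext => z; rewrite /gB /patch indicE.
  by case: ifP => _; rewrite ?mul1e ?mul0e.
have mH : measurable_fun [set: R * n.-tuple R]
    (fun p => \int[leb R n]_z F (p, z)).
  exact: (@measurable_fun_fubini_tonelli_F _ _ _ _ _ (leb R n) F mF F0).
rewrite /leb_pair fubini_tonelli1//=; last by move=> p; exact: integral_ge0.
pose c := (2 ^+ n)%:E * \int[leb R n]_z gB z.
have c0 : 0 <= c by rewrite mule_ge0 ?integral_ge0// lee_fin exprn_ge0.
apply: (@le_trans _ _ (\int[@leb1 R]_s ((\1_`[0%R, r]%classic s)%:E * c))).
  apply: ge0_le_integral_nonmeas => s _.
    by apply: integral_ge0 => y _; exact: integral_ge0.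
  rewrite /fubini_F/= indicE.
  have mFs : measurable_fun [set: n.-tuple R * n.-tuple R]
      (fun q => F ((s, q.1), q.2)).
    apply: (measurableT_comp mF); apply/measurable_fun_pairP; split; last first.
      exact: measurable_snd.
    apply: (measurableT_comp (pair1_measurable s)).
    exact: measurable_fst.
  have -> : \int[leb R n]_y \int[leb R n]_z F ((s, y), z) =
      \int[leb R n]_z \int[leb R n]_y F ((s, y), z).
    exact: (@fubini_tonelli _ _ _ _ _ (leb R n) (leb R n) _ mFs
      (fun q => F0 ((s, q.1), q.2))).
  have [/set_mem sI|sI] := boolP (s \in _); last first.
    rewrite mul0e integral0_eq// => z _; rewrite integral0_eq// => y _.
    by rewrite /F /I/= indicE (negbTE sI) !mul0e.
  rewrite mul1e /c -ge0_integralZl//.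
  apply: ge0_le_integral_nonmeas => z _; first exact: integral_ge0.
  have -> : (fun y => F (s, y, z)) = (fun y => (ball_kernel x (s, y) z)%:E * gB z).
    by apply/funext => y; rewrite /F /I/= indicE mem_set// mul1e.
  rewrite ge0_integralZr//.
  - rewrite lee_wpmul2r//; apply: integral_ball_kernel.
    by move: sI; rewrite /= in_itv/= => /andP[].
  - apply/measurable_EFinP.
    exact: (measurableT_comp mk
      (measurableT_comp (pair2_measurable z) (pair1_measurable s))).
  - by move=> y _; rewrite lee_fin ball_kernel_ge0.
rewrite ge0_integralZr//; last by apply/measurable_EFinP; exact: measurable_indic.
rewrite integral_indic// setIT [X in X * _](_ : _ = r%:E).
  by rewrite /c muleA -EFinM mulrC.
transitivity (@lebesgue_measure R `[0%R, r]%classic) => //.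
rewrite lebesgue_measure_itv/= lte_fin oppr0 adde0.
by move: r0; rewrite le_eqVlt => /predU1P[<-|->//]; rewrite ltxx.
Qed.

End Kernel.

(** * Comparison with the centred maximal function *)

(** The integral is the volume of the ball times an average that the maximal
    function dominates; the volume is nonzero and finite, so the extended-real
    quotient behaves as expected. *)
Lemma integral_eball_le_HL (R : realType) (n : nat) (f : n.-tuple R -> \bar R)
    (x : n.-tuple R) (s : R) : 0 < s ->
  (\int[leb R n]_(z in eball x s) `|f z|
    <= ((2 * s) ^+ n)%:E * HL_maximal_centered f x)%E.
Proof.
move=> s0; set I := (X in (X <= _)%E).
have I0 : (0 <= I)%E by apply: integral_ge0.
have B0 := leb_eball_gt0 x s0.
have BV := leb_eball_le x (ltW s0).
have Bfin : leb R n (eball x s) \is a fin_num.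
  by rewrite ge0_fin_numE// (le_lt_trans BV)// ltry.
have avg : ((leb R n (eball x s))^-1 * I <= HL_maximal_centered f x)%E.
  by apply: ereal_sup_ubound; exists s.
apply: (@le_trans _ _ (leb R n (eball x s) * ((leb R n (eball x s))^-1 * I))%E).
  by rewrite muleA divee ?mul1e ?gt_eqF.
have avg0 : (0 <= (leb R n (eball x s))^-1 * I)%E.
  by rewrite mule_ge0// inve_ge0 ltW.
by apply: lee_pmul => //; exact: ltW.
Qed.

(** The constant does not depend on [r]: the density contributes r^-(n+1), the
    integration in s contributes r, and the ball B(x, 2 r) contributes at most
    (4 r)^n. *)
Lemma expectation_ball_average_le (R : realType) (n : nat) (d : measure_display)
    (Omega : measurableType d) (P : probability Omega R)
    (eps : {RV P >-> R}) (y : {RV P >-> n.-tuple R})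
    (gamma : R * n.-tuple R -> R) (A : R) (r : R) :
  (forall w, 0 < eps w) ->
  has_density (joint_law P eps y) gamma ->
  0 < A -> 0 < r ->
  supp gamma `<=` `[0, r] `*` eball (vzero R n) r ->
  (Linfty_norm gamma <= (A / r ^+ n.+1)%:E)%E ->
  forall (f : n.-tuple R -> \bar R) (x : n.-tuple R),
  completed_measurable_fun (leb R n) f ->
  (\int[P]_w \int[leb R n]_z
     (((eps w ^+ n)^-1
        * (\1_(`]0, 1[) : R -> R) (enorm (vsub (vsub x (y w)) z) / eps w))%:E
      * `|f z|)
   <= (A * 8 ^+ n)%:E * HL_maximal_centered f x)%E.
Proof.
move=> eps0 dens A0 r0 sK nrm f x mf.
have [g [mg g0 gf gN]] := completed_measurable_representative mf.
pose K : set (R * n.-tuple R) := `[0, r] `*` eball (vzero R n) r.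
have mK : measurable K.
  by apply: measurableX; [exact: measurable_itv|exact: measurable_eball].
pose h p := (\int[leb R n]_z ((ball_kernel x p z)%:E * g z))%E.
have mh : measurable_fun [set: R * n.-tuple R] h by exact: measurable_ball_kernel_integral.
have h0 p : (0 <= h p)%E.
  by apply: integral_ge0 => z _; rewrite mule_ge0// lee_fin ball_kernel_ge0.
have mX : measurable_fun [set: Omega] (fun w => (eps w, y w)).
  by apply/measurable_fun_pairP; split => /=; exact: measurable_funPT.
pose c := A / r ^+ n.+1.
have c0 : 0 <= c by rewrite divr_ge0 ?exprn_ge0 ?ltW.
apply: (@le_trans _ _ (\int[P]_w h (eps w, y w))%E).
  apply: ge0_le_integral_nonmeas => w _.
    apply: integral_ge0 => z _; rewrite mule_ge0// lee_fin mulr_ge0//.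
    by rewrite invr_ge0 exprn_ge0// ltW.
  have mkw : measurable_fun [set: n.-tuple R]
      (fun z => (ball_kernel x (eps w, y w) z)%:E * g z)%E.
    apply: emeasurable_funM => //; apply/measurable_EFinP.
    exact: (measurableT_comp (measurable_ball_kernel x) (pair1_measurable (eps w, y w))).
  apply: (ge0_ae_le_integral_nonmeas measurableT gN) => //.
  - move=> z _; rewrite mule_ge0// lee_fin mulr_ge0//.
    by rewrite invr_ge0 exprn_ge0// ltW.
  - by move=> z _; rewrite mule_ge0// lee_fin ball_kernel_ge0.
  - move=> z _ /negP/negPn/eqP gz; rewrite /= gz lee_wpmul2r// lee_fin.
    rewrite /ball_kernel/= indicE; have [/set_mem|_] := boolP (_ \in _).
      rewrite /= in_itv/= => /andP[_]; rewrite ltr_pdivrMr// mul1r => ->.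
      by rewrite mulr1.
    by rewrite mulr0; case: ifP => // _; rewrite invr_ge0 exprn_ge0// ltW.
pose Pi := [the {measure set (R * n.-tuple R)%type -> \bar R} of
  measure_function_pushforward__canonical__measure_function_Measure P mX].
have -> : (\int[P]_w h (eps w, y w) = \int[Pi]_p h p)%E.
  by rewrite (ge0_integral_pushforward mX).
apply: (le_trans (@ge0_integral_dominated _ _ _ Pi (leb_pair R n) c K h c0 mK _ h0 mh)).
  by move=> E mE; apply: (has_density_le dens).
apply: (@le_trans _ _ (c%:E * ((2 ^+ n * r)%:E *
    \int[leb R n]_(z in eball x (2 * r)) g z))%E).
  by rewrite lee_wpmul2l ?lee_fin//; apply: integral_ball_kernel_le => //; exact: ltW.
have r20 : 0 < 2 * r by rewrite mulr_gt0.
apply: (@le_trans _ _ (c%:E * ((2 ^+ n * r)%:E *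
    (((2 * (2 * r)) ^+ n)%:E * HL_maximal_centered f x)))%E).
  rewrite lee_wpmul2l ?lee_fin// lee_wpmul2l//.
    by rewrite lee_fin mulr_ge0 ?exprn_ge0// ltW.
  apply: le_trans _ (integral_eball_le_HL f x r20).
  by apply: ge0_le_integral_nonmeas => z _; [exact: g0|exact: gf].
rewrite !muleA -!EFinM (_ : c * _ * _ = A * 8 ^+ n)// /c.
rewrite (_ : 8 = 2 * 2 * 2 :> R); last by ring.
rewrite !exprMn exprSr.
have rn0 : r ^+ n != 0 by rewrite expf_neq0 ?gt_eqF.
by field; rewrite rn0 gt_eqF.
Qed.

Theorem theorem3p6 (R : realType) (n : nat) (d : measure_display)
    (Omega : measurableType d) (P : probability Omega R)
    (eps : nat -> {RV P >-> R}) (y : nat -> {RV P >-> n.-tuple R})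
    (gamma : nat -> R * n.-tuple R -> R) (A : R) (r : nat -> R) :
  (1 <= n)%N ->
  (forall j, (1 <= j)%N -> forall w, 0 < eps j w) ->
  (forall j, (1 <= j)%N -> has_density (joint_law P (eps j) (y j)) (gamma j)) ->
  0 < A ->
  (forall j, (1 <= j)%N -> 0 < r j) ->
  (forall j, (1 <= j)%N ->
    supp (gamma j) `<=` `[0, r j] `*` eball (vzero R n) (r j)) ->
  (forall j, (1 <= j)%N ->
    (Linfty_norm (gamma j) <= (A / r j ^+ n.+1)%:E)%E) ->
  exists2 C : R, 0 < C &
    forall f : n.-tuple R -> \bar R,
      completed_measurable_fun (leb R n) f ->
      forall x : n.-tuple R,
        (stochastic_maximal P (\1_(`]0, 1[) : R -> R)%R eps y f x
          <= C%:E * HL_maximal_centered f x)%E.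
Proof.
move=> _ eps0 dens A0 r0 sK nrm; exists (A * 8 ^+ n).
  by rewrite mulr_gt0// exprn_gt0.
move=> f mf x; apply: ge_ereal_sup => _ [j j1 <-].
exact: (@expectation_ball_average_le _ _ _ _ _ _ _ (gamma j) A (r j) (eps0 j j1) (dens j j1)
  A0 (r0 j j1) (sK j j1) (nrm j j1)).
Qed.
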